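(* Let $(F,v)$ be a henselian real valued field of characteristic $p>0$. Let $E$ be an extension (separable or not) of $F$ of degree $p$, viewed as a valued $F$-vector space via the unique extension of $v$ to $E$, and suppose $x\in E$ generates $E$ over $F$. Put $T=\{1,x,\dots,x^{p-1}\}$, viewed as a basis of $E$ over $F$. Then \[ d(T)=(p-1)\,\mathrm{ndist}(x,F). \]
   Context: A (real) valued field $(F,v)$ is a field $F$ with a function $v:F\to\mathbb{R}\cup\{\infty\}$ such that $v(x)=\infty$ iff $x=0$, $v(x+y)\ge\min\{v(x),v(y)\}$, and $v(xy)=v(x)+v(y)$. If $F$ is henselian, $v$ extends uniquely to a valuation on every finite extension $E$ of $F$ (again denoted $v$). Discrepancy: for an $F$-basis $T=\{\mathbf e_1,\dots,\mathbf e_n\}$ of $E$ and $0\neq\mathbf v=c_1\mathbf e_1+\cdots+c_n\mathbf e_n\in E$ with $c_i\in F$, put $d(T;\mathbf v)=v(\mathbf v)-\min_i\{v(c_i\mathbf e_i)\}\ge 0$, and $d(T)=\sup_{\mathbf v\ne0}d(T;\mathbf v)\in[0,\infty]$. Normalized distance: for $0\ne x\in E$, $\mathrm{ndist}(x,F)=\sup\{v(x-y)-v(x):y\in F\}\in[0,\infty]$. *)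

(* Defs.v *)
From HB Require Import structures.
From mathcomp Require Import all_boot all_order all_algebra all_field.
From mathcomp Require Import all_classical all_reals ereal.

Set Implicit Arguments.
Unset Strict Implicit.
Unset Printing Implicit Defensive.

Import Order.TTheory GRing.Theory Num.Theory.

Local Open Scope classical_set_scope.
Local Open Scope ring_scope.
Local Open Scope ereal_scope.

(* The value group lies in the reals, so the value -oo is excluded. *)
Definition valuation (R : realType) (K : fieldType) (v : K -> \bar R) : Prop :=
  [/\ forall a, v a != -oo,
      forall a, v a = +oo <-> a = 0%R,
      forall a b, Order.min (v a) (v b) <= v (a + b)%R
    & forall a b, v (a * b)%R = v a + v b].

Definition extends_valuation (R : realType) (F : fieldType) (E : fieldExtType F)
    (v : F -> \bar R) (w : E -> \bar R) : Prop :=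
  forall a : F, w (a%:A)%R = v a.

Section Henselian.
Variables (R : realType) (F : fieldType) (v : F -> \bar R).

Definition integral_poly (f : {poly F}) : Prop := forall i, 0 <= v f`_i.

Definition primitive_poly (f : {poly F}) : Prop :=
  integral_poly f /\ exists i, v f`_i = 0.

(* Equality of the reductions, for f and g with coefficients in the valuation
   ring. *)
Definition eq_residue (f g : {poly F}) : Prop := forall i, 0 < v (f - g)%R`_i.

(* Hensel's lemma for the valuation ring O: if a primitive f in O[X] reduces
   to a product of two coprime polynomials over the residue field, then the
   factorization lifts to O[X], with a first factor of the same degree as its
   reduction.  The residual factors are given by lifts g0 and h0 to O[X], with
   g0 chosen of the same degree as its reduction (i.e., with unit leading
   coefficient); their coprimality is expressed by a Bezout relation. *)
Definition henselian : Prop :=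
  forall f g0 h0 : {poly F},
    primitive_poly f ->
    integral_poly g0 -> integral_poly h0 -> v (lead_coef g0) = 0 ->
    eq_residue f (g0 * h0)%R ->
    (exists a b : {poly F}, [/\ integral_poly a, integral_poly b
      & eq_residue (a * g0 + b * h0)%R 1%R]) ->
    exists g h : {poly F},
      [/\ integral_poly g /\ integral_poly h, f = (g * h)%R,
          size g = size g0, eq_residue g g0 & eq_residue h h0].

End Henselian.

Section Discrepancy.
Variables (R : realType) (F : fieldType) (E : fieldExtType F).
Variable w : E -> \bar R.

(* Meaningful when T is an F-basis of E, so that coord T i u is the i-th
   coordinate of u. *)
Definition discrepancy_at (n : nat) (T : n.-tuple E) (u : E) : \bar R :=
  w u - \big[Order.min/+oo]_(i < n) w (coord T i u *: tnth T i)%R.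

Definition discrepancy (n : nat) (T : n.-tuple E) : \bar R :=
  ereal_sup [set discrepancy_at T u | u in [set u | u != 0%R]].

Definition ndist (x : E) : \bar R :=
  ereal_sup [set w (x - y%:A)%R - w x | y in [set: F]].

End Discrepancy.

Definition power_tuple (F : fieldType) (E : fieldExtType F) (n : nat) (x : E) :
    n.-tuple E :=
  [tuple (x ^+ i)%R | i < n].

Lemma power_tuple_basis (F : fieldType) (E : fieldExtType F) (n : nat) (x : E) :
  \dim {:E} = n -> <<1; x>>%VS = {:E}%VS -> basis_of {:E} (power_tuple n x).
Proof.
move=> dimE genx.
have degx : adjoin_degree 1 x = n.
  by rewrite -dimE -genx dim_Fadjoin dimv1 muln1.
rewrite basisEdim size_tuple dimE leqnn andbT.
apply/subvP => u _.
have /Fadjoin_poly_eq <- : u \in <<1; x>>%VS by rewrite genx memvf.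
have Sr : (size (Fadjoin_poly 1 x u) <= n)%N by rewrite -degx size_Fadjoin_poly.
rewrite (horner_coef_wide _ Sr).
apply: memv_suml => i _.
have /polyOverP/(_ i)/vlineP[c ->] := Fadjoin_polyOver 1 x u.
rewrite -scalerAl mul1r; apply/memvZ/memv_span.
by apply/mapP; exists i => //; rewrite mem_enum.
Qed.

(* Main.v *)
(* Let [s = w x] and [delta = ndist x].  The top coordinate of [(x - y)^(p-1)] is
   [1], so that [d(T) >= (p-1) (w (x - y) - s)] for all [y] in [F].

   Conversely, let [u = f(x)] with [deg f < p].  The minimum in [d(T; u)] is the
   Gauss norm of [f] with the variable given the value [s], and this norm is
   multiplicative, so that [f] may be supposed monic and irreducible, of degree
   [m < p].  As [m] is prime to [p], [g = f(X + x)] is irreducible over [E]; it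
   divides a polynomial that is irreducible over [F], whose Newton polygon is a
   segment by Hensel's lemma, and by multiplicativity of the Gauss norms over [E]
   the Newton polygon of [g] is then a segment too.  Its first and next to last
   coefficients are [f(x)] and [m (x - y)], with [y] in [F] the mean of the roots
   of [f], and [m] is a unit: thus [w (f(x)) <= m w (x - y) <= m (s + delta)].
   The Newton polygon of [f] being also a segment, the Gauss norm of [f] is the
   least of [m s] and [v (f(0))], and [w (f(x)) = v (f(0))] if [v (f(0)) < m s]. *)

Require Import Defs.
From mathcomp Require Import all_boot all_order all_algebra all_field.
From mathcomp Require Import all_classical all_reals ereal.
From mathcomp Require Import ring lra zify.

Import Order.TTheory GRing.Theory Num.Theory.

Local Open Scope ring_scope.

(** * Irreducible and minimal polynomials under field extension *)

Lemma irreducible_factor {K : fieldType} (f : {poly K}) :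
  (1 < size f)%N -> exists g, [/\ irreducible_poly g, g \is monic & g %| f].
Proof.
have [n] := ubnP (size f); elim: n f => // n IHn f lefn f_gt1.
have [[q [q1 q_gt1 q_lt]]|irrf] :=
    pselect (exists q, [/\ q %| f, (1 < size q)%N & (size q < size f)%N]).
  have [g [irrg mong gq]] := IHn q (leq_trans q_lt lefn) q_gt1.
  by exists g; split => //; apply: dvdp_trans q1.
have f0 : f != 0 by rewrite -size_poly_gt0 (ltn_trans _ f_gt1).
have lc0 : (lead_coef f)^-1 != 0 by rewrite invr_eq0 lead_coef_eq0.
exists ((lead_coef f)^-1 *: f); split; last by rewrite dvdpZl.
  split=> [|q q1]; first by rewrite size_scale.
  rewrite dvdpZr // => qf; rewrite eqp_sym; apply: eqp_trans (eqp_scale _ lc0) _.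
  rewrite eqp_sym -(dvdp_size_eqp qf) eqn_leq dvdp_leq //=.
  rewrite leqNgt; apply/negP => qlt; apply: irrf; exists q; split=> //.
  have q0 : q != 0 by apply: contraNneq f0 => q0; rewrite q0 dvd0p in qf.
  by rewrite ltn_neqAle eq_sym q1 size_poly_gt0.
by rewrite monicE lead_coefZ mulVf // lead_coef_eq0.
Qed.

(** Coprimality is preserved by [iota] and excludes a common root, so [gcdp g q] is not constant and
    is associated with [g]. *)
Lemma irreducible_dvdp_root {K L : fieldType} {iota : {rmorphism K -> L}}
    {g q : {poly K}} {z : L} :
  irreducible_poly g -> root (map_poly iota g) z -> root (map_poly iota q) z ->
  g %| q.
Proof.
move=> irrg gz qz; have [cop|ncop] := boolP (coprimep g q).
  move: cop; rewrite -(coprimep_map iota) => /coprimep_root/(_ gz).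
  by rewrite -rootE qz.
have := apply_irredp irrg ncop (dvdp_gcdl g q).
by move/eqp_dvdl => <-; exact: dvdp_gcdr.
Qed.

(** Hensel's lemma and irreducibility over the base field need the minimal polynomial in [{poly K}]
    rather than in [{poly L}]. *)
Lemma minPoly_base {K : fieldType} {L : fieldExtType K} (z : L) :
  exists h : {poly K}, [/\ h \is monic, irreducible_poly h
    & map_poly (in_alg L) h = minPoly 1 z].
Proof.
have /polyOver1P[h Dh] := minPolyOver 1%AS z.
exists h; rewrite Dh; split=> //.
  by rewrite -(map_monic (in_alg L)) -Dh monic_minPoly.
split=> [|q q1 qh].
  by rewrite -(size_map_poly (in_alg L)) -Dh size_minPoly.
have qK : map_poly (in_alg L) q \is a polyOver 1%AS by apply/polyOver1P; exists q.
have := minPoly_irr (K := 1%AS) (x := z) qK; rewrite [minPoly _ _]Dh dvdp_map => /(_ qh).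
rewrite eqp_map => /orP[//|]; rewrite -size_poly_eq1 size_map_poly => /eqP q1'.
by rewrite q1' in q1.
Qed.

(* As [deg f] is prime to the degree of [E], [f] stays irreducible over [E], and
   so does its translate, which thus divides the minimal polynomial over [F] of
   any of its roots. *)
Lemma coprime_translate_dvdp {F : fieldType} {E : fieldExtType F}
    (f : {poly F}) (x : E) :
  irreducible_poly f -> coprime (size f).-1 (\dim {:E}) ->
  exists h : {poly F}, [/\ h \is monic, irreducible_poly h
    & (map_poly (in_alg E) f \Po ('X + x%:P)) %| map_poly (in_alg E) h].
Proof.
move=> irrf cop; set G := _ \Po _.
have f_gt1 : (1 < size f)%N by case: irrf.
have szG : size G = size f by rewrite size_comp_poly2 ?size_XaddC // size_map_poly.
have [g [irrg mong gG]] : exists g, [/\ irreducible_poly g, g \is monic & g %| G].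
  by apply: irreducible_factor; rewrite szG.
have [L dimL [z gz _]] := irredp_FAdjoin irrg.
(* [L0] is [L] viewed as an extension of [F], for counting degrees over [F]. *)
pose L0 := baseFieldType L.
have in_algL0 (q : {poly F}) :
    map_poly (in_alg L0) q = map_poly (in_alg L) (map_poly (in_alg E) q).
  rewrite -map_poly_comp; apply: eq_map_poly => c /=.
  by rewrite baseField_scaleE.
have Gz : root (map_poly (in_alg L) G) z.
  by move: gG; rewrite -(dvdp_map (in_alg L)) => /dvdpP[k ->]; rewrite rootM gz orbT.
pose a : L0 := z + in_alg L x.
have fa : root (map_poly (in_alg L0) f) a.
  rewrite in_algL0; move: Gz; rewrite /G map_comp_poly rmorphD /= map_polyX map_polyC /=.
  by rewrite /root horner_comp !hornerE.
have [ha [monha irrha Dha]] := minPoly_base a.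
have haa : root (map_poly (in_alg L0) ha) a by rewrite Dha root_minPoly.
have fha : f %= ha.
  by rewrite /eqp (irreducible_dvdp_root irrf fa haa)
    (irreducible_dvdp_root irrha haa fa).
have dima : \dim <<1; a>> = (size f).-1.
  rewrite (eqp_size fha) -(size_map_poly (in_alg L0)) Dha size_minPoly.
  by rewrite dim_Fadjoin dimv1 muln1.
(* By the tower law [deg f] divides [[L : F] = deg g * [E : F]]; being prime to [[E : F]], it
   divides [deg g]. *)
have := field_dimS (subvf <<1; a>>%AS); rewrite /= dima.
have -> : \dim {:L0} = ((size g).-1 * \dim {:E})%N.
  rewrite -dimL -dim_baseVspace; congr (\dim _).
  by apply/vspaceP => u; rewrite mem_baseVspace; apply/idP/idP => _; exact: memvf.
rewrite Gauss_dvdl // => /dvdn_leq szfg.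
have g_gt1 : (1 < size g)%N by case: irrg.
have Gg : g %= G.
  have G0 : G != 0 by rewrite -size_poly_gt0 szG ltnW.
  rewrite -(dvdp_size_eqp gG) eqn_leq dvdp_leq //= szG.
  have := szfg _; case: (size g) g_gt1 => // -[] // n _ /(_ isT).
  by case: (size f).
have [h [monh irrh Dh]] := minPoly_base (z : L0).
exists h; split=> //; rewrite -(eqp_dvdl _ Gg).
apply: irreducible_dvdp_root irrg gz _.
by have := root_minPoly 1%AS (z : L0); rewrite -[minPoly _ _]Dh in_algL0.
Qed.

(** * Valuations and Gauss norms *)

(* [gauss_ge v s c f] says that the Newton polygon of [f] lies above the line of
   slope [-s] through [(0, c)], and [gauss v s c f] that it touches this line:
   then [c] is the Gauss norm of [f] for which the variable has value [s]. *)
Definition gauss_ge {R : realType} {K : fieldType} (v : K -> \bar R)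
    (s c : R) (f : {poly K}) :=
  forall i : nat, ((c - i%:R * s)%:E <= v f`_i)%E.

Definition gauss {R : realType} {K : fieldType} (v : K -> \bar R)
    (s c : R) (f : {poly K}) :=
  gauss_ge v s c f /\ exists i : nat, v f`_i = (c - i%:R * s)%:E.

Section Valuation.
Context {R : realType} {K : fieldType} {v : K -> \bar R}.
Hypothesis val_v : valuation v.
Implicit Types (a b : K) (r : R).

Lemma val0 : v 0 = +oo%E.
Proof. by case: val_v => _ v0 _ _; apply/v0. Qed.

Lemma valM a b : v (a * b) = (v a + v b)%E.
Proof. by case: val_v. Qed.

Lemma val_fin a : a != 0 -> exists r, v a = r%:E.
Proof.
case: val_v => vNy v0 _ _ a0; move: (vNy a) (v0 a).
case: (v a) => [r|//|//] _; first by exists r.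
by case=> /(_ erefl) a0'; rewrite a0' eqxx in a0.
Qed.

Lemma val_neq0 a r : v a = r%:E -> a != 0.
Proof. by move=> va; apply: contra_eq_neq va => ->; rewrite val0. Qed.

Lemma val1 : v 1 = 0%E.
Proof.
have [r vr] := val_fin _ (oner_neq0 K).
by have := valM 1 1; rewrite mulr1 vr => -[] rr; congr (_%:E); lra.
Qed.

Lemma valX a n r : v a = r%:E -> v (a ^+ n) = (n%:R * r)%:E.
Proof.
move=> va; elim: n => [|n IHn]; first by rewrite expr0 val1 mul0r.
by rewrite exprS valM va IHn -EFinD -natr1 mulrDl mul1r addrC.
Qed.

Lemma valN a : v (- a) = v a.
Proof.
have N1 : -1 != 0 :> K by rewrite oppr_eq0 oner_neq0.
have [r vr] := val_fin _ N1.
have := valM (-1) (-1); rewrite mulrNN mulr1 val1 vr => -[] rr.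
rewrite -mulN1r valM vr; have -> : r = 0 by lra.
by rewrite add0e.
Qed.

Lemma valV a r : v a = r%:E -> v a^-1 = (- r)%:E.
Proof.
move=> va; have a0 := val_neq0 _ _ va.
have [s vs] := val_fin _ (invr_neq0 a0).
have := valM a a^-1; rewrite mulfV // val1 va vs => -[] rs.
by congr (_%:E); lra.
Qed.

Lemma val_sum_ge (I : Type) (s : seq I) (P : pred I) (f : I -> K) (c : \bar R) :
  (forall i, P i -> (c <= v (f i))%E) -> (c <= v (\sum_(i <- s | P i) f i))%E.
Proof.
move=> cf; elim/big_ind: _ => //; first by rewrite val0 leey.
case: val_v => _ _ vD _ a b ca cb; apply: le_trans (vD a b).
by rewrite le_min ca.
Qed.

Lemma val_sum_gt (I : Type) (s : seq I) (P : pred I) (f : I -> K) r :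
  (forall i, P i -> (r%:E < v (f i))%E) -> (r%:E < v (\sum_(i <- s | P i) f i))%E.
Proof.
move=> cf; elim/big_ind: _ => //; first by rewrite val0 ltry.
case: val_v => _ _ vD _ a b ca cb; apply: lt_le_trans (vD a b).
by rewrite lt_min ca.
Qed.

Lemma val_addl a b r : v a = r%:E -> (r%:E < v b)%E -> v (a + b) = r%:E.
Proof.
case: val_v => _ _ vD _ va vb; apply/eqP; rewrite eq_le; apply/andP; split.
  rewrite leNgt; apply/negP => vab.
  by have := vD (a + b) (- b); rewrite addrK va valN leNgt lt_min vb vab.
by apply: le_trans (vD a b); rewrite le_min va lexx ltW.
Qed.

(** Frobenius fixes the prime field, so that [p * v n = v n]. *)
Lemma val_natr (p n : nat) : p \in [pchar K] -> ~~ (p %| n)%N -> v n%:R = 0%E.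
Proof.
move=> pK pn; have n0 : n%:R != 0 :> K by rewrite -(dvdn_pcharf pK).
have [r vr] : exists r, v n%:R = r%:E by apply: val_fin n0.
have := valX _ p _ vr; rewrite -(pFrobenius_autE pK) pFrobenius_aut_nat vr => -[] rr.
have p1 : (1 < p)%N by rewrite prime_gt1 // (pcharf_prime pK).
congr (_%:E); apply/eqP; have : (p%:R - 1) * r = 0 by lra.
move/eqP; rewrite mulf_eq0 => /orP[|//]; rewrite subr_eq0.
by rewrite pnatr_eq1 => /eqP p1'; rewrite p1' in p1.
Qed.

Lemma gauss_geM s c d f g :
  gauss_ge v s c f -> gauss_ge v s d g -> gauss_ge v s (c + d) (f * g).
Proof.
move=> cf dg i; rewrite coefM; apply: val_sum_ge => j _; rewrite valM.
have -> : (c + d - i%:R * s)%:E = ((c - j%:R * s)%:E + (d - (i - j)%:R * s)%:E)%E.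
  rewrite -EFinD natrB; last by rewrite -ltnS.
  by congr (_%:E); ring.
exact: leeD.
Qed.

Lemma gauss_exists s f : f != 0 -> exists c, gauss v s c f.
Proof.
move=> f0; pose F (i : 'I_(size f)) := (v f`_i + (i%:R * s)%:E)%E.
have sz0 : (0 < size f)%N by rewrite size_poly_gt0.
have szP : ((size f).-1 < size f)%N by rewrite ltn_predL.
have [i _ Hi] := Order.TotalTheory.arg_minP (i0 := Ordinal szP) (P := xpredT) F isT.
(* The leading coefficient has finite value, hence the minimum is finite. *)
have [d vd] : exists d, v (lead_coef f) = d%:E by apply: val_fin; rewrite lead_coef_eq0.
have [r vi] : exists r, v f`_i = r%:E.
  have := Hi (Ordinal szP) isT; rewrite /F -/(lead_coef f) vd -EFinD.
  by case: val_v => vNy _ _ _; move: (vNy f`_i); case: (v _) => // r; exists r.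
exists (r + i%:R * s); split; last by exists i; rewrite vi addrK.
move=> j; have [jf|jf] := ltnP j (size f); last by rewrite nth_default // val0 leey.
have := Hi (Ordinal jf) isT; rewrite /F vi /= -EFinD.
case: (v f`_j) => // t; rewrite -?EFinD ?lee_fin ?leey // => H; lra.
Qed.

Lemma gauss_unique s c d f : gauss v s c f -> gauss v s d f -> c = d.
Proof.
move=> [cf [i ci]] [df [j dj]]; apply/eqP; rewrite eq_le.
have := cf j; have := df i; rewrite ci dj !lee_fin => *.
by apply/andP; split; lra.
Qed.

(* The product of the terms of highest index on the two lines is not cancelled. *)
Lemma gaussM s c d f g : gauss v s c f -> gauss v s d g -> gauss v s (c + d) (f * g).
Proof.
move=> [cf exf] [dg exg]; split; first exact: gauss_geM.
have bnd (h : {poly K}) e (i : nat) :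
    v h`_i == (e - i%:R * s)%:E -> (i <= size h)%N.
  move=> /eqP/val_neq0; apply: contraR; rewrite -ltnNge => ih.
  by rewrite nth_default // ltnW.
have exfb : exists i : nat, v f`_i == (c - i%:R * s)%:E
  by case: exf => i /eqP; exists i.
have exgb : exists i : nat, v g`_i == (d - i%:R * s)%:E
  by case: exg => i /eqP; exists i.
have [i /eqP fi maxi] := ex_maxnP exfb (bnd f c).
have [j /eqP gj maxj] := ex_maxnP exgb (bnd g d).
exists (i + j)%N; have iij : (i < (i + j).+1)%N by rewrite ltnS leq_addr.
rewrite coefM (bigD1 (Ordinal iij)) //= addKn.
apply: val_addl; first by rewrite valM fi gj -EFinD; congr (_%:E); rewrite natrD; ring.
apply: val_sum_gt => k; rewrite -val_eqE /= => ki; rewrite valM.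
have kij : (k <= i + j)%N by rewrite -ltnS.
have -> : c + d - (i + j)%:R * s = (c - k%:R * s) + (d - (i + j - k)%:R * s).
  by rewrite natrB //; ring.
rewrite EFinD; case: (ltngtP k i) ki => // ki _.
  apply: lee_ltD => //; rewrite lt_neqAle dg andbT eq_sym.
  by apply/negP => /maxj; lia.
apply: lte_leD => //; rewrite lt_neqAle cf andbT eq_sym.
by apply/negP => /maxi; lia.
Qed.

(* Meant for the lowest or the highest coefficients. *)
Lemma gauss_factor s c f g i j :
  gauss_ge v s c (f * g) -> (f * g)`_(i + j) = f`_i * g`_j ->
  v (f * g)`_(i + j) = (c - (i + j)%:R * s)%:E ->
  exists2 a, gauss v s a f & v f`_i = (a - i%:R * s)%:E.
Proof.
move=> cfg Dfg vfg.
have f0 : f != 0 by apply: contra_eq_neq vfg => ->; rewrite mul0r coef0 val0.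
have g0 : g != 0 by apply: contra_eq_neq vfg => ->; rewrite mulr0 coef0 val0.
have [a af] := gauss_exists s _ f0; have [b bg] := gauss_exists s _ g0.
exists a => //.
have Dc : a + b = c.
  by apply: gauss_unique (gaussM _ _ _ _ _ af bg) _; split=> //; exists (i + j)%N.
(* Two lower bounds whose sum is an equality are both equalities. *)
have := af.1 i; have := bg.1 j; move: vfg; rewrite Dfg valM -Dc.
case: (v f`_i) => [x||]; case: (v g`_j) => [y||] //; rewrite -EFinD => -[] xy.
by rewrite !lee_fin natrD in xy * => ? ?; congr (_%:E); lra.
Qed.

Lemma gauss_factor0 s c f g :
  gauss_ge v s c (f * g) -> v (f * g)`_0 = c%:E ->
  exists2 a, gauss v s a f & v f`_0 = a%:E.
Proof.
move=> cfg vfg; have [||a ga va] := gauss_factor _ _ _ _ 0 0 cfg.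
- by rewrite coef0M.
- by rewrite vfg mul0r subr0.
by exists a; rewrite // va mul0r subr0.
Qed.

Lemma gauss_factor_lead s c f g :
  gauss_ge v s c (f * g) ->
  v (lead_coef (f * g)) = (c - (size (f * g)).-1%:R * s)%:E ->
  exists2 a, gauss v s a f & v (lead_coef f) = (a - (size f).-1%:R * s)%:E.
Proof.
move=> cfg vfg; have := val_neq0 _ _ vfg.
rewrite lead_coef_eq0 mulf_eq0 negb_or => /andP[f0 g0].
have Dsz : (size (f * g)).-1 = ((size f).-1 + (size g).-1)%N.
  rewrite size_mul //; move: f0 g0; rewrite -(size_poly_gt0 f) -(size_poly_gt0 g).
  by case: (size f) (size g) => // m [//|n] _ _; rewrite addSn addnS.
apply: (gauss_factor _ _ _ _ _ (size g).-1 cfg); rewrite -Dsz //.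
by rewrite -!lead_coefE lead_coefM.
Qed.

End Valuation.

(** * Newton polygons over a henselian field *)

(* If the minimal value of the coefficients is not reached at either end, then
   the reduction of the primitive multiple of [f] has a degree strictly between
   [0] and [deg f], and Hensel's lemma lifts its factorization by [1]. *)
Lemma henselian_irreducible {R : realType} {F : fieldType} {v : F -> \bar R}
    (f : {poly F}) :
  valuation v -> henselian v -> irreducible_poly f ->
  exists2 c, gauss_ge v 0 c f & v f`_0 = c%:E \/ v (lead_coef f) = c%:E.
Proof.
move=> val_v hens irrf; have f0 := irredp_neq0 irrf.
have [c [cf [i fi]]] := gauss_exists val_v 0 f f0.
rewrite mulr0 subr0 in fi; have b0 := val_neq0 val_v _ _ fi.
(* Division by a coefficient of least value makes [f1] primitive. *)
set b := f`_i in fi b0; pose f1 := b^-1 *: f.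
exists c => //.
have vb j : v f`_j = (c%:E + v f1`_j)%E.
  by rewrite coefZ (valM val_v) (valV val_v _ _ fi) addeA -EFinD subrr add0e.
have f1_ge0 j : (0 <= v f1`_j)%E.
  by have := cf j; rewrite mulr0 subr0 vb -[X in (X <= _)%E]adde0 leeD2lE.
have f1_ex : exists d, v f1`_d == 0%E.
  by exists i; rewrite coefZ mulVf // (val1 val_v) eqxx.
have szf1 : size f1 = size f by rewrite size_scale // invr_eq0.
have f1_bnd d : v f1`_d == 0%E -> (d <= (size f).-1)%N.
  move=> /eqP/(val_neq0 val_v _ 0); apply: contraR; rewrite -ltnNge => jf.
  by rewrite nth_default // szf1; case: (size f) jf.
(* [d] is the degree of the reduction of [f1]. *)
have [d /eqP fd maxd] := ex_maxnP f1_ex f1_bnd.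
have [d0|d_gt0] := posnP d; first by left; rewrite vb -d0 fd adde0.
have := f1_bnd d; rewrite fd eqxx => /(_ isT).
rewrite leq_eqVlt => /orP[/eqP df|d_lt].
  by right; rewrite lead_coefE vb -df fd adde0.
(* Truncation keeps the reduction of [f1] and gives a unit leading coefficient; the Hensel lift of
   [g0] is then a factor of [f] of degree [d]. *)
exfalso; pose g0 := take_poly d.+1 f1.
have g0E j : g0`_j = if (j < d.+1)%N then f1`_j else 0 by rewrite coef_take_poly.
have g0d : g0`_d = f1`_d by rewrite g0E ltnSn.
have f1d : f1`_d != 0 by apply: (val_neq0 val_v _ 0).
have szg0 : size g0 = d.+1.
  apply/eqP; rewrite eqn_leq size_take_poly ltnNge.
  by apply/negP => /(nth_default 0)/eqP; rewrite g0d (negPf f1d).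
have v0 := val0 val_v.
have v1 := val1 val_v.
have int0 : Defs.integral_poly v 0 by move=> j; rewrite coef0 v0 leey.
have int1 : Defs.integral_poly v 1.
  by move=> j; rewrite coef1; case: eqP => _; rewrite ?v0 ?v1 ?leey.
have [||||||g [h [_ Df szg _ _]]] := hens f1 g0 1.
- by split=> //; exists d.
- by move=> j; rewrite g0E; case: ifP; rewrite ?v0 ?leey.
- exact: int1.
- by rewrite lead_coefE szg0 g0d.
- move=> j; rewrite mulr1 coefB g0E ltnS; case: ifP => jd; first by rewrite subrr v0 ltry.
  rewrite subr0 lt_neqAle f1_ge0 andbT eq_sym; apply/negP => /maxd.
  by rewrite jd.
- by exists 0, 1; split=> // j; rewrite mul0r mul1r add0r subrr coef0 v0 ltry.
have gf : g %| f by rewrite -(dvdpZr (c := b^-1)) ?invr_eq0 // -/f1 Df dvdp_mulr.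
have := apply_irredp irrf _ gf; rewrite szg szg0 eqSS -lt0n => /(_ d_gt0).
by move/eqp_size; rewrite szg szg0 => Dd; move: d_lt; rewrite -Dd ltnn.
Qed.

(* For [z] a root of [h] and [n = deg h], apply [henselian_irreducible] to the
   minimal polynomial [r] of [t = z ^ n / h(0)]: [h] divides [r(X ^ n / h(0))],
   whose Newton polygon touches a line of slope [- v(h(0)) / n] at one end. *)
Lemma henselian_newton {R : realType} {F : fieldType} {v : F -> \bar R}
    (h : {poly F}) (rho : R) :
  valuation v -> henselian v -> irreducible_poly h -> h \is monic ->
  v h`_0 = rho%:E -> gauss_ge v (rho / (size h).-1%:R) rho h.
Proof.
move=> val_v hens irrh monh vh0; have h0 := val_neq0 val_v _ _ vh0.
have n_gt0 : (0 < (size h).-1)%N by case: irrh; case: (size h) => [|[]].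
set n := (size h).-1 in n_gt0 *; set s := rho / n%:R.
have ns : n%:R * s = rho by rewrite mulrC divfK // pnatr_eq0 -lt0n.
have [L _ [z hz _]] := irredp_FAdjoin irrh.
have [r [monr irrr Dr]] := minPoly_base (z ^+ n * in_alg L (h`_0)^-1).
(* [q] is [r(X / h(0))]. *)
pose q := \poly_(i < size r) (r`_i * h`_0 ^- i).
have lq : r`_(size r).-1 * h`_0 ^- (size r).-1 != 0.
  by rewrite -lead_coefE (monicP monr) mul1r invr_eq0 expf_neq0.
have szr : (0 < size r)%N by rewrite size_poly_gt0 monic_neq0.
have szq : size q = size r by rewrite size_poly_eq // .
have qE i : q`_i = r`_i * h`_0 ^- i.
  by rewrite coef_poly; case: ltnP => // /(nth_default 0)->; rewrite mul0r.
have hQ : h %| q \Po 'X^n.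
  apply: (irreducible_dvdp_root irrh hz).
  have := root_minPoly 1%AS (z ^+ n * in_alg L (h`_0)^-1); rewrite -[minPoly _ _]Dr.
  rewrite map_comp_poly map_polyXn /root horner_comp hornerXn.
  rewrite !horner_coef !size_map_poly szq; congr (_ == 0); apply: eq_bigr => i _.
  rewrite !coef_map /= qE exprMn -exprM mulrCA -scalerAl mul1r.
  by rewrite exprZn expr1n scalerA exprVn mulr_algr mulr_algl.
have vq i : v q`_i = (v r`_i - (i%:R * rho)%:E)%E.
  by rewrite qE (valM val_v) (valV val_v _ (i%:R * rho)) // (valX val_v _ _ rho).
have [c cr endr] := henselian_irreducible r val_v hens irrr.
(* Index [k] moves to [k * n], and [n * s = rho] absorbs the value of [h(0)^-k]. *)
have cQ : gauss_ge v s c (q \Po 'X^n).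
  move=> i; rewrite coef_comp_poly_Xn //; case: ifP => [|_]; last first.
    by rewrite (val0 val_v) leey.
  move=> /dvdnP[k ->]; rewrite mulnK // vq natrM -mulrA ns EFinB leeD2r //.
  by have := cr k; rewrite mulr0 subr0.
suff [a ah Da] : exists2 a, gauss v s a h & a = rho by rewrite -Da; case: ah.
have [k Dk] := dvdpP _ _ hQ; rewrite mulrC in Dk; rewrite Dk in cQ.
(* Either end of [h] determines its Gauss norm: [v (h(0)) = rho] at the low one, [0 + n * s = rho]
   at the high one. *)
case: endr => [r0c|rlc].
  have [|a ah va] := gauss_factor0 val_v s c h k cQ.
    by rewrite -Dk coef_comp_poly_Xn // dvdn0 div0n vq r0c mul0r sube0.
  by exists a => //; move: va; rewrite vh0 => -[].
have [|a ah va] := gauss_factor_lead val_v s c h k cQ.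
  rewrite -Dk lead_coefE size_comp_poly size_polyXn /= szq coef_comp_poly_Xn //.
  by rewrite dvdn_mull // mulnK // vq -lead_coefE rlc natrM -mulrA ns EFinB.
exists a => //; move: va; rewrite (monicP monh) (val1 val_v) -/n ns => -[]; lra.
Qed.

(** Over [E] the polynomial [h] may split, but both ends of its polygon stay on the supporting line;
    by multiplicativity so do both ends of [g], and monicity of [g] fixes its norm. *)
Lemma newton_dvdp {R : realType} {F : fieldType} {v : F -> \bar R}
    {E : fieldExtType F} {w : E -> \bar R} (h : {poly F}) (g : {poly E}) :
  valuation v -> henselian v -> valuation w -> extends_valuation v w ->
  irreducible_poly h -> h \is monic ->
  g \is monic -> (1 < size g)%N -> g`_0 != 0 -> g %| map_poly (in_alg E) h ->
  exists2 s, w g`_0 = ((size g).-1%:R * s)%:E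
    & gauss_ge w s ((size g).-1%:R * s) g.
Proof.
move=> val_v hens val_w ext irrh monh mong g_gt1 g0 gh.
(* Otherwise [h] is associated with ['X], hence so is [g], and [g(0) = 0]. *)
have h0 : h`_0 != 0.
  apply/eqP; rewrite -horner_coef0 => /rootP; rewrite -dvdp_XsubCl subr0 => Xh.
  have := apply_irredp irrh _ Xh; rewrite size_polyX => /(_ isT).
  rewrite -(eqp_map (in_alg E)) map_polyX => hX.
  have gX : g %| 'X - 0%:P by rewrite subr0 (eqp_dvdr g hX).
  have := apply_irredp (irredp_XsubC 0) _ gX; rewrite gtn_eqF //.
  move=> /(_ isT)/eqp_root/(_ 0).
  by rewrite root_XsubC eqxx /root horner_coef0 (negPf g0).
have [k Dk] := dvdpP _ _ gh; rewrite mulrC in Dk.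
have [rho vh0] := val_fin val_v _ h0.
have n_gt0 : (0 < (size h).-1)%N by case: irrh; case: (size h) => [|[]].
have := henselian_newton h rho val_v hens irrh monh vh0.
set n := (size h).-1 in n_gt0 *; set s := rho / n%:R => hge.
have ns : n%:R * s = rho by rewrite mulrC divfK // pnatr_eq0 -lt0n.
have whE i : w (map_poly (in_alg E) h)`_i = v h`_i by rewrite coef_map /= ext.
have gkge : gauss_ge w s rho (g * k) by move=> i; rewrite -Dk whE.
have [|a ag wg0] := gauss_factor0 val_w s rho g k gkge; first by rewrite -Dk whE.
have [|b bg wlg] := gauss_factor_lead val_w s rho g k gkge.
  rewrite -Dk lead_coef_map /= ext (monicP monh) (val1 val_v).
  by rewrite size_map_poly -/n ns subrr.
have Da : a = (size g).-1%:R * s.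
  rewrite (gauss_unique _ _ _ _ ag bg).
  by move: wlg; rewrite (monicP mong) (val1 val_w) => -[]; lra.
by exists s; rewrite -Da //; case: ag.
Qed.

Lemma size_exp_XaddC (A : nzRingType) (c : A) n : size (('X + c%:P) ^+ n) = n.+1.
Proof. by rewrite -[c]opprK polyCN size_exp_XsubC. Qed.

Lemma coef_exp_XaddC (A : comNzRingType) (c : A) k :
  (('X + c%:P) ^+ k.+1)`_k = k.+1%:R * c.
Proof.
have lc n : (('X + c%:P) ^+ n)`_n = 1.
  have := monic_exp n (monicXaddC c); rewrite monicE lead_coefE.
  by rewrite size_exp_XaddC => /eqP.
elim: k => [|k IHk]; first by rewrite expr1 coefD coefX coefC mul1r add0r.
rewrite exprSr mulrDr coefD coefMX /= IHk coefMC lc mul1r.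
by rewrite -[k.+2%:R]natr1 mulrDl mul1r.
Qed.

(** The segment below the Newton polygon of [f(X + x)] starts at [f(x)] and ends at the leading
    coefficient [1], so its height at index [m] is [s]. *)
Lemma val_translate {R : realType} {F : fieldType} {v : F -> \bar R}
    {E : fieldExtType F} {w : E -> \bar R} (f : {poly F}) (m : nat) (x : E) :
  valuation v -> henselian v -> valuation w -> extends_valuation v w ->
  irreducible_poly f -> f \is monic -> size f = m.+2 -> coprime m.+1 (\dim {:E}) ->
  (map_poly (in_alg E) f).[x] != 0 ->
  exists2 s, w (map_poly (in_alg E) f).[x] = (m.+1%:R * s)%:E
    & (s%:E <= w (m.+1%:R * x + (f`_m)%:A)%R)%E.
Proof.
move=> val_v hens val_w ext irrf monf szf cop fx0.
have [h [monh irrh]] : exists h : {poly F}, [/\ h \is monic, irreducible_poly h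
    & (map_poly (in_alg E) f \Po ('X + x%:P)) %| map_poly (in_alg E) h].
  by apply: coprime_translate_dvdp; rewrite ?szf.
set G := _ \Po _ => Gh.
have G0 : G`_0 = (map_poly (in_alg E) f).[x].
  by rewrite -horner_coef0 horner_comp !hornerE.
have szG : size G = m.+2 by rewrite size_comp_poly2 ?size_XaddC // size_map_poly.
have monG : G \is monic.
  rewrite monicE lead_coef_comp ?size_XaddC // lead_coef_map (monicP monf) /=.
  by rewrite (monicP (monicXaddC x)) expr1n mulr1 scale1r.
have Gm : G`_m = m.+1%:R * x + (f`_m)%:A.
  (* Only the powers [m] and [m.+1] of [X + x] reach index [m]. *)
  rewrite /G comp_polyE size_map_poly szf coef_sum !big_ord_recr /= big1 => [|i _].
    have -> : (map_poly (in_alg E) f)`_m.+1 = 1.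
      by have := monicP monf; rewrite coef_map lead_coefE szf /= => ->; rewrite scale1r.
    rewrite add0r scale1r coef_exp_XaddC addrC coefZ coef_map.
    have := monicP (monic_exp m (monicXaddC x)); rewrite lead_coefE size_exp_XaddC.
    by move=> ->; rewrite mulr1.
  by rewrite coefZ [_`_m]nth_default ?mulr0 // size_exp_XaddC.
have [||s wG0 Gge] := newton_dvdp h G val_v hens val_w ext irrh monh monG _ _ Gh.
- by rewrite szG.
- by rewrite G0.
exists s; first by rewrite -G0 wG0 szG.
have := Gge m; rewrite Gm szG; congr (_ <= _)%E.
by congr (_%:E); rewrite -natr1; ring.
Qed.

(** * The discrepancy of a power basis *)

Section PrimeDegree.
Context {R : realType} {F : fieldType} {v : F -> \bar R} {p : nat}.
Context {E : fieldExtType F} {w : E -> \bar R} {x : E}.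
Hypotheses (val_v : valuation v) (hens : henselian v) (pF : p \in [pchar F]).
Hypotheses (dimE : \dim {:E} = p) (val_w : valuation w).
Hypotheses (ext : extends_valuation v w) (genx : <<1%VS; x>>%VS = {:E}%VS).

Lemma horner_gen_neq0 (q : {poly F}) :
  q != 0 -> (size q <= p)%N -> (map_poly (in_alg E) q).[x] != 0.
Proof.
move=> q0 szq; apply/negP => qx.
have qE : map_poly (in_alg E) q \is a polyOver 1%AS by apply/polyOver1P; exists q.
have := dvdp_leq _ (minPoly_dvdp qE qx); rewrite map_poly_eq0 => /(_ q0).
rewrite size_map_poly size_minPoly adjoin_degreeE genx dimE dimv1 divn1 => pq.
by have := leq_trans pq szq; rewrite ltnn.
Qed.

Lemma gen_neq0 : x != 0.
Proof.
have := horner_gen_neq0 'X; rewrite polyX_eq0 size_polyX map_polyX hornerX; apply=> //.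
by rewrite prime_gt1 // (pcharf_prime pF).
Qed.

Section Bound.
Context {s delta : R}.
Hypotheses (wx : w x = s%:E) (delta_ge0 : 0 <= delta).
Hypothesis near : forall y : F, (w (x - y%:A)%R <= (s + delta)%:E)%E.

(** For [deg f < p], [c] bounds the minimum in [d(T; f(x))] from below, whence
    [d(T; f(x)) <= deg f * delta]. Both estimates add up under products. *)
Let bounded (f : {poly F}) := exists2 c, gauss_ge v s c f
  & (w (map_poly (in_alg E) f).[x] <= (c + (size f).-1%:R * delta)%:E)%E.

Lemma bounded_irreducible (f : {poly F}) :
  irreducible_poly f -> f \is monic -> (size f <= p)%N -> bounded f.
Proof.
move=> irrf monf szfp; have [m szf] : exists m, size f = m.+2.
  by case: irrf; case: (size f) => [|[|m]] // _ _; exists m.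
have pr_p := pcharf_prime pF.
have cop : coprime m.+1 (\dim {:E}).
  rewrite dimE coprime_sym prime_coprime // gtnNdvd //.
  by rewrite -szf.
have fx0 : (map_poly (in_alg E) f).[x] != 0.
  by apply: horner_gen_neq0 => //; exact: irredp_neq0.
have [sg wfx sgle] := val_translate f m x val_v hens val_w ext irrf monf szf cop fx0.
have m0 : m.+1%:R != 0 :> F by rewrite -(dvdn_pcharf pF) gtnNdvd // -ltnS -szf ltnS.
(* The element subtracted from [x] is the mean of the roots of [f]. *)
have Dw : w (m.+1%:R * x + (f`_m)%:A) = w (x - (- (f`_m / m.+1%:R))%:A).
  have -> : m.+1%:R * x + (f`_m)%:A = m.+1%:R * (x - (- (f`_m / m.+1%:R))%:A).
    rewrite scaleNr opprK mulrDr; congr (_ + _).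
    by rewrite mulr_natl -scaler_nat scalerA mulrC divfK.
  rewrite (valM val_w) (val_natr val_w p) ?add0e //.
    by rewrite (fmorph_pchar (in_alg E)).
  by rewrite gtnNdvd // -ltnS -szf ltnS.
have sg_le : sg <= s + delta.
  by rewrite -lee_fin; apply: le_trans (near (- (f`_m / m.+1%:R))); rewrite -Dw.
have m_ge0 : 0 <= m.+1%:R :> R by [].
(* A zero constant coefficient has infinite value and defines no slope; then [f = 'X]. *)
have [f00|f00] := eqVneq f`_0 0.
  have Xf : 'X %| f by rewrite -(subr0 'X) dvdp_XsubCl /root horner_coef0 f00.
  have Df : f = 'X.
    apply/eqP; rewrite -eqp_monic ?monicX // eqp_sym.
    by have := apply_irredp irrf _ Xf; rewrite size_polyX; apply.
  exists s; last by rewrite Df map_polyX hornerX wx size_polyX mul1r lee_fin lerDl.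
  move=> i; rewrite Df coefX; case: eqP => [->|_].
    by rewrite (val1 val_v) mul1r subrr.
  by rewrite (val0 val_v) leey.
rewrite /bounded szf wfx /=.
have [rho vf0] := val_fin val_v _ f00.
have := henselian_newton f rho val_v hens irrf monf vf0; rewrite szf /=.
set t := rho / m.+1%:R => fge.
have tm : m.+1%:R * t = rho by rewrite mulrC divfK // pnatr_eq0.
(* [t] is the value of the roots of [f]. If [s <= t], the leading term gives the norm [m.+1 * s];
   otherwise the constant term gives [rho]. *)
have [st|ts] := lerP s t.
  exists (m.+1%:R * s); last by rewrite lee_fin -mulrDr ler_wpM2l.
  move=> i; have [im|im] := leqP i m.+1; last first.
    by rewrite nth_default ?szf // (val0 val_v) leey.
  apply: le_trans (fge i); rewrite lee_fin -tm -!mulrBl -natrB //.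
  by rewrite ler_wpM2l.
exists rho.
  move=> i; apply: le_trans (fge i); rewrite lee_fin lerD2l lerN2 ler_wpM2l //.
  exact: ltW.
rewrite -wfx; apply: le_trans (_ : rho%:E <= _)%E; last first.
  by rewrite lee_fin lerDl mulr_ge0.
rewrite horner_coef size_map_poly szf big_ord_recl expr0 mulr1 coef_map /=.
rewrite (val_addl val_w _ _ rho) ?ext //.
(* As [t < s], every later term of [f(x)] has value above [rho]. *)
apply: (val_sum_gt val_w) => i _; rewrite coef_map (valM val_w) /= ext.
rewrite (valX val_w _ _ s wx); set j := bump 0 i.
apply: lt_le_trans (leeD2r _ (fge j)); rewrite -EFinD lte_fin.
have : j%:R * t < j%:R * s by rewrite ltr_pM2l ?ltr0n.
by lra.
Qed.

(** Induction on the degree, splitting off an irreducible factor. *)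
Lemma bounded_poly (f : {poly F}) : f != 0 -> (size f <= p)%N -> bounded f.
Proof.
have [n] := ubnP (size f); elim: n f => // n IHn f lefn f0 szf.
have [f1|f_gt1] := leqP (size f) 1.
  rewrite (size1_polyC f1) in f0 *; rewrite polyC_eq0 in f0.
  have [c vc] := val_fin val_v _ f0.
  exists c; last by rewrite size_polyC f0 map_polyC hornerC mul0r addr0 /= ext vc.
  move=> [|i]; rewrite coefC /= ?vc ?(val0 val_v) ?leey //.
  by rewrite mul0r subr0.
have [g [irrg mong gf]] := irreducible_factor f f_gt1.
have [k Df] : exists k : {poly F}, f = k * g by apply/dvdpP.
have k0 : k != 0 by apply: contra_neq f0 => k0; rewrite Df k0 mul0r.
have g_gt1 : (1 < size g)%N by case: irrg.
have Dsz : size f = (size k + (size g).-1)%N.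
  by rewrite Df size_mul ?(monic_neq0 mong) // -!subn1 addnBA // ltnW.
have kgt0 : (0 < size k)%N by rewrite size_poly_gt0.
have ltkf : (size k < size f)%N by rewrite Dsz -addn1 leq_add2l -subn1 subn_gt0.
have [||c ck wk] := IHn k _ k0.
- exact: leq_trans ltkf lefn.
- exact: leq_trans (ltnW ltkf) szf.
have [|d dg wg] := bounded_irreducible g irrg mong.
  exact: leq_trans (dvdp_leq f0 gf) szf.
exists (c + d).
  by rewrite Df; apply: gauss_geM.
rewrite Df rmorphM hornerM (valM val_w); apply: le_trans (leeD wk wg) _.
rewrite -EFinD lee_fin -Df Dsz.
have -> : ((size k + (size g).-1).-1 = (size k).-1 + (size g).-1)%N.
  by case: (size k) kgt0 => // l _; rewrite addSn.
by rewrite natrD mulrDl; lra.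
Qed.

End Bound.
End PrimeDegree.

Lemma nth_power_tuple {F : fieldType} {E : fieldExtType F} n (x : E) (i : 'I_n) :
  (power_tuple n x)`_i = (x ^+ i)%R.
Proof. by rewrite -tnth_nth tnth_mktuple. Qed.

Lemma horner_alg_wide {F : fieldType} {E : fieldExtType F} n (q : {poly F}) (x : E) :
  (size q <= n)%N ->
  (map_poly (in_alg E) q).[x]%R = (\sum_(i < n) q`_i *: (power_tuple n x)`_i)%R.
Proof.
move=> szq; rewrite (@horner_coef_wide _ n) ?size_map_poly //.
apply: eq_bigr => i _; rewrite coef_map nth_power_tuple.
by rewrite mulr_algl.
Qed.

Local Open Scope ereal_scope.

Theorem proposition5p2 (R : realType) (F : fieldType) (v : F -> \bar R)
    (p : nat) (E : fieldExtType F) (w : E -> \bar R) (x : E) :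
  valuation v -> henselian v -> p \in [pchar F] ->
  \dim {:E} = p ->
  valuation w -> extends_valuation v w ->
  <<1%VS; x>>%VS = {:E}%VS ->
  discrepancy w (power_tuple p x) = (p.-1)%:R%:E * ndist w x.
Proof.
move=> val_v hens pF dimE val_w ext genx.
have p_gt1 : (1 < p)%N by rewrite prime_gt1 // (pcharf_prime pF).
have bT := power_tuple_basis dimE genx.
have x0 := gen_neq0 pF dimE genx.
have [s wx] := val_fin val_w _ x0.
have ndist_ge0 : 0 <= ndist w x.
  by apply: ereal_sup_ubound; exists 0%R => //; rewrite scale0r subr0 wx -EFinB subrr.
have q0 : (0 < p.-1%:R :> R)%R by rewrite ltr0n -subn1 subn_gt0.
apply/eqP; rewrite eq_le; apply/andP; split.
  (* If the distance is infinite, so is the right-hand side, since [p.-1 > 0]. *)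
  have [ndoo|ndoo] := eqVneq (ndist w x) +oo.
    by rewrite ndoo gt0_muley ?lte_fin ?leey.
  have [delta Dnd] : exists delta, ndist w x = delta%:E.
    by case: (ndist w x) ndist_ge0 ndoo => // d; exists d.
  have delta_ge0 : (0 <= delta)%R by rewrite -lee_fin -Dnd.
  have near y : w (x - y%:A)%R <= (s + delta)%:E.
    have : w (x - y%:A)%R - w x <= ndist w x by apply: ereal_sup_ubound; exists y.
    by rewrite Dnd wx leeBlDr // -EFinD [(s + delta)%R]addrC.
  rewrite Dnd; apply: ge_ereal_sup => _ [u /= u0 <-]; rewrite /discrepancy_at.
  (* The coordinates of [u] are the coefficients of a polynomial [q] with [q(x) = u]. *)
  pose q := rVpoly (\row_i coord (power_tuple p x) i u).
  have qE (i : 'I_p) : q`_i = coord (power_tuple p x) i u.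
    by rewrite coef_rVpoly_ord mxE.
  have szq : (size q <= p)%N by exact: size_poly.
  have qx : (map_poly (in_alg E) q).[x]%R = u.
    rewrite (horner_alg_wide _ _ _ szq) [RHS](coord_basis bT (memvf u)).
    by apply: eq_bigr => i _; rewrite qE.
  have qn0 : q != 0%R by apply: contraNneq u0 => q00; rewrite -qx q00 rmorph0 horner0.
  have [c qc] := bounded_poly val_v hens pF dimE val_w ext genx
    wx delta_ge0 near q qn0 szq.
  rewrite qx => wu_le.
  apply: (@le_trans _ _ ((c + (size q).-1%:R * delta)%:E - c%:E)).
    apply: leeB => //; apply: le_bigmin => [|i _]; first exact: leey.
    rewrite tnth_mktuple -qE -mulr_algl (valM val_w) ext (valX val_w _ _ s wx).
    by apply: le_trans (leeD2r _ (qc i)); rewrite -EFinD subrK.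
  rewrite -EFinB -EFinM lee_fin addrAC subrr add0r ler_wpM2r // ler_nat.
  by rewrite -!subn1 leq_sub2r.
(* For the converse, the positive factor [p.-1] passes inside the supremum, and each [y] is treated
   separately. *)
rewrite /ndist -ereal_sup_pZl //; apply: ge_ereal_sup => _ [_ [y _ <-] <-].
have pp : (p.-1 < p)%N by rewrite ltn_predL ltnW.
pose q : {poly F} := (('X - y%:P) ^+ p.-1)%R.
have szq : size q = p by rewrite size_exp_XsubC prednK // ltnW.
have qx : (map_poly (in_alg E) q).[x]%R = ((x - y%:A) ^+ p.-1)%R.
  by rewrite rmorphXn rmorphB /= map_polyX map_polyC !hornerE.
(* [x] is not in [F], because [p > 1]. *)
have xy0 : (x - y%:A != 0)%R.
  have := horner_gen_neq0 dimE genx ('X - y%:P).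
  by rewrite size_XsubC polyXsubC_eq0 rmorphB /= map_polyX map_polyC !hornerE; apply.
have [r wxy] := val_fin val_w _ xy0.
pose u := ((x - y%:A) ^+ p.-1)%R.
apply: (@le_trans _ _ (discrepancy_at w (power_tuple p x) u)); last first.
  by apply: ereal_sup_ubound; exists u => //=; rewrite expf_neq0.
rewrite /discrepancy_at (valX val_w _ _ r wxy) wxy wx -EFinB -EFinM mulrBr EFinB.
(* The minimum is at most its term of index [p.-1], whose coordinate is [1] because [q] is monic. *)
apply: leeB => //; apply: (bigmin_inf (Ordinal pp)) => //.
rewrite tnth_mktuple /= /u -qx (horner_alg_wide p) ?szq //.
rewrite coord_sum_free; last exact: basis_free bT.
have -> : q`_(Ordinal pp) = 1%R.
  by have := monicP (monic_exp p.-1 (monicXsubC y)); rewrite lead_coefE -/q szq.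
by rewrite scale1r (valX val_w _ _ s wx).
Qed.
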